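(* Let $\beta\in(1,2)$ be a Garsia number. Then for Lebesgue almost every $x\in I_{\beta}$ there exists a $\beta$-expansion $(\epsilon_i)_{i=1}^\infty$ of $x$ which satisfies the inequalities $$0\leq x-\sum_{i=1}^{n}\frac{\epsilon_{i}}{\beta^{i}}\leq \frac{1}{n2^{n}\log n}$$ for infinitely many integers $n\geq 2$.
   Context: For $\beta\in(1,2)$ let $I_{\beta}:=[0,\frac{1}{\beta-1}]$. A $\beta$-expansion of $x\in I_\beta$ is a sequence $(\epsilon_{i})_{i=1}^{\infty}\in\{0,1\}^{\mathbb{N}}$ with $x=\sum_{i=1}^{\infty}\epsilon_{i}\beta^{-i}$, where $\mathbb{N}=\{1,2,3,\ldots\}$. A Garsia number is a positive real algebraic integer with norm $\pm 2$ whose conjugates all have modulus strictly greater than $1$ (the norm of an algebraic integer is the product of it with all of its other Galois conjugates). *)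

(* Defs.v *)
From HB Require Import structures.
From mathcomp Require Import all_boot all_order all_algebra.
From mathcomp Require Import all_classical all_reals all_analysis.
From mathcomp Require Import complex.

Set Implicit Arguments.
Unset Strict Implicit.
Unset Printing Implicit Defensive.

Import Order.TTheory GRing.Theory Num.Theory.
Import numFieldNormedType.Exports.

Local Open Scope classical_set_scope.
Local Open Scope ring_scope.

Definition is_min_poly (K : fieldType) (p : {poly rat}) (z : K) : Prop :=
  [/\ p \is monic, irreducible_poly p & root (map_poly ratr p) z].

(* The conjugates of b include b itself; as the minimal polynomial is separable,
   each of its roots is to be counted once, so a set suffices. *)
Definition conjugates (R : realType) (b : R) : set R[i] :=
  [set z | exists2 p : {poly rat},
     is_min_poly p b & root (map_poly ratr p) z].

Definition galois_norm (R : realType) (b : R) : R[i] :=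
  \big[*%R/1]_(z \in conjugates b) z.

Definition algebraic_integer (R : realType) (b : R) : Prop :=
  integralOver (intr : int -> R) b.

Definition garsia_number (R : realType) (b : R) : Prop :=
  [/\ 0 < b, algebraic_integer b,
      galois_norm b = 2 \/ galois_norm b = - 2
    & forall z, conjugates b z -> 1 < `|z| ].

Definition beta_interval (R : realType) (b : R) : set R :=
  `[0, 1 / (b - 1)]%classic.

(* Digits are indexed from 1: the value eps 0 is never used. *)
Definition beta_sum (R : realType) (b : R) (eps : nat -> bool) (n : nat) : R :=
  \sum_(1 <= i < n.+1) (eps i)%:R / b ^+ i.

Definition beta_expansion (R : realType) (b x : R) (eps : nat -> bool) : Prop :=
  beta_sum b eps n @[n --> \oo] --> x.

(* Main.v *)
Require Import Defs.
From HB Require Import structures.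
From mathcomp Require Import all_boot all_order all_algebra.
From mathcomp Require Import all_classical all_reals all_analysis.
From mathcomp Require Import complex measurable_realfun separable.
From mathcomp Require Import zify ring lra.

Set Implicit Arguments.
Unset Strict Implicit.
Unset Printing Implicit Defensive.

Import Order.TTheory GRing.Theory Num.Theory.
Import numFieldNormedType.Exports.

Local Open Scope classical_set_scope.
Local Open Scope ring_scope.

(** Write [s_w] for the value of a finite word [w] of digits, so that the
truncations of expansions are the [s_w], and put [a_n = 1/((n+2) log (n+2))]
and [psi n = a_n / 2^n]; this is at most the allowed error, and the sum of the
[2^n psi n = a_n] diverges.

Arithmetic enters once, through Garsia's separation property: two distinct
words of length [n] satisfy [|s_u - s_v| >= C / 2^n]. Indeed
[b^n (s_u - s_v) = Q(b)] for a nonzero polynomial [Q] with coefficients in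
[{-1, 0, 1}]. No conjugate of [b] is a root of such a [Q], because the minimal
polynomial of [b] has constant coefficient [+-2] and would divide [Q]. So the
product of [Q] over all conjugates is a nonzero integer, while each factor
[|Q(z)|] with [z] different from [b] is at most [|z|^n / (|z| - 1)], and the
product of these [|z|] is [2 / b]. Hence [|Q(b)| >= C (b/2)^n]
([garsia_horner_lower_bound], [garsia_separation]).

Let [V] be the set of the [x] such that, for every [c > 0], one has
[0 <= x - s_w <= c psi |w|] for words [w] of arbitrarily large length.

- [V] has positive measure. Fix [c], and let [S] be the sum of the indicators
  of the intervals [[s_w, s_w + c psi |w|]] over a long range of lengths, with
  integral [A]. Separation bounds the number of words of a given length near a
  given point, so that the integral of [S^2] is at most [(2/C) A^2 + 4 A]. As
  [A] can be made large, the second moment inequality gives the union of the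
  intervals a measure of at least [C / 4]. This bound depends neither on [c]
  nor on the first length of the range, so it passes to the decreasing
  intersection [V] ([mu_union_near_words], [mu_well_approx_ge]).

- [V] then has full measure. It is stable under the contractions
  [y |-> s_w + y / b^|w|], since prepending [w] multiplies the ratio of the
  error to [psi] by at most [8^|w|], which a smaller [c] absorbs. Every [x] of
  the interval lies in the image of the interval under contractions of
  arbitrarily small ratio, hence [V] occupies a fixed proportion of small balls
  around [x], and by Lebesgue's density theorem almost every such [x] lies in
  [V] ([ae_well_approx]).

- One expansion suffices. For almost every [x], each point
  [(x - s_w) b^|w|] that falls in the interval lies in [V]. Starting from the
  empty word, one extends [w] by a word [v] that approximates this point well
  enough for [w ++ v] to approximate [x] within [psi |w ++ v|]; the new
  remainder is again in the interval, and the limit of these words is the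
  expansion ([well_approx_extend], [beta_expansion_glue]). *)

(** * Polynomials with small coefficients at Garsia numbers *)

Local Notation intp := (map_poly intr).
Local Notation ratp := (map_poly ratr).

(** The product is the determinant of [Q] evaluated at the companion matrix of
[p], which has integer entries. To compare the two over an algebraically closed
field, split [Q] (and not [p]) into linear factors: the determinant of [A - w] is
the product of the [z - w] over the roots [z] of the characteristic polynomial. *)
Lemma prod_root_int (K : closedFieldType) (p Q : {poly int}) (rs : seq K) :
  p \is monic -> intp p = \prod_(z <- rs) ('X - z%:P) ->
  exists m : int, \prod_(z <- rs) (intp Q).[z] = m%:~R.
Proof.
move=> pmonic pE.
have size_rs : (size p).-1 = size rs.
  have : size (intp p : {poly K}) = size p.
    by rewrite size_map_poly_id0// (monicP pmonic) rmorph1 oner_neq0.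
  by rewrite pE size_prod_XsubC => <-.
have := companionmxK pmonic; move: (companionmx p); rewrite size_rs.
(* Evaluation of polynomials at a matrix requires a positive size. *)
case: rs pE size_rs => [|z0 rs] pE size_rs M charM.
  by exists 1; rewrite big_nil.
move: pE size_rs M charM; set n := size rs; set zs := z0 :: rs => pE size_rs M charM.
exists (\det (horner_mx M Q)).
have -> : (\det (horner_mx M Q))%:~R = \det (horner_mx (map_mx intr M) (intp Q)) :> K.
  by rewrite -map_horner_mx det_map_mx.
set A := map_mx _ _.
have detA w : \det (A - w%:M) = \prod_(z <- zs) (z - w).
  have -> : A - w%:M = - map_mx (horner_eval w) (char_poly_mx A).
    apply/matrixP => i j; rewrite !mxE /horner_eval.
    by case: (i == j) => /=; rewrite ?mulr1n ?mulr0n !hornerE /= ?opprB //; ring.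
  rewrite -scaleN1r detZ det_map_mx.
  rewrite -/(char_poly A) /A -map_char_poly charM pE.
  rewrite -[LHS]/((-1) ^+ (size zs) * (\prod_(z <- zs) ('X - z%:P)).[w]) horner_prod.
  elim: (zs) => [|z s IH]; first by rewrite !big_nil mulr1.
  by rewrite !big_cons -IH /= exprS hornerXsubC; ring.
have [ws QE] := closed_field_poly_normal (intp Q : {poly K}).
move: QE; set c := lead_coef _ => ->.
have -> : \det (horner_mx A (c *: \prod_(w <- ws) ('X - w%:P))) =
   c ^+ n.+1 * \prod_(w <- ws) \det (A - w%:M).
  rewrite linearZ detZ rmorph_prod; congr (_ * _).
  rewrite (big_morph (@determinant K n.+1) (@det_mulmx _ _) (@det1 _ _)).
  by apply: eq_bigr => w _; rewrite rmorphB /= horner_mx_X horner_mx_C.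
under [in RHS]eq_bigr do rewrite detA.
rewrite exchange_big /= -[n.+1]/(size zs).
elim: (zs) => [|z s IH]; first by rewrite !big_nil mulr1.
rewrite !big_cons IH hornerZ horner_prod /= exprS.
under eq_bigr do rewrite hornerXsubC.
ring.
Qed.

Lemma ratp_intp (K : numFieldType) (q : {poly int}) : ratp (intp q) = intp q :> {poly K}.
Proof. by rewrite -map_poly_comp; apply: eq_map_poly => x /=; rewrite ratr_int. Qed.

(** A nonzero polynomial of least size among those that vanish at [x] is
irreducible. *)
Lemma exists_min_poly (K : numFieldType) (q : {poly rat}) (x : K) :
  q != 0 -> root (ratp q) x -> exists p, is_min_poly p x.
Proof.
move=> q0 qx.
pose P n := `[< exists q : {poly rat}, [/\ q != 0, root (ratp q) x & size q = n] >].
have exP : exists n, P n by exists (size q); apply/asboolP; exists q.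
case: (ex_minnP exP) => n /asboolP[{q0 qx}q [q0 qx <-]] qmin.
have lc0 : lead_coef q != 0 by rewrite lead_coef_eq0.
exists ((lead_coef q)^-1 *: q); split.
- by rewrite monicE lead_coefZ mulVf.
- split.
    rewrite size_scale ?invr_eq0//.
    rewrite -(size_map_poly (@ratr K : {rmorphism rat -> K})).
    by apply: (@root_size_gt1 _ x); rewrite // map_poly_eq0.
  move=> d; rewrite dvdpZr ?invr_eq0// => d1 dq.
  rewrite eqp_sym (eqp_trans (eqp_scale q _)) ?invr_eq0// eqp_sym.
  have qE := divpK dq; set e := q %/ d in qE.
  have [e0 d0] : e != 0 /\ d != 0.
    by apply/andP; rewrite -negb_or -mulf_eq0 qE.
  have min_size f : f != 0 -> root (ratp f) x -> (size q <= size f)%N.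
    by move=> f0 fx; apply: qmin; apply/asboolP; exists f.
  rewrite -dvdp_size_eqp// eqn_leq dvdp_leq//=.
  move: qx; rewrite -{1}qE rmorphM rootM => /orP[ex|/min_size->//].
  have := min_size _ e0 ex; rewrite -{1}qE size_mul//.
  have : (0 < size d)%N by rewrite size_poly_gt0.
  have : (0 < size e)%N by rewrite size_poly_gt0.
  move: d1; move: (size d) (size e) => *; lia.
- by rewrite linearZ /= rootZ// fmorph_eq0 invr_eq0.
Qed.

(** Were [p] not to divide [q], the two would be coprime and could not share the
root [x]. *)
Lemma min_poly_uniq (K : numFieldType) (p q : {poly rat}) (x : K) :
  is_min_poly p x -> is_min_poly q x -> p = q.
Proof.
move=> [pm pirr px] [qm qirr qx].
have pq : p %| q.
  apply: contraTT isT => pNq.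
  have : coprimep (ratp p : {poly K}) (ratp q).
    by rewrite coprimep_map irreducible_poly_coprime.
  by move/coprimep_root => /(_ _ px); rewrite -/(root _ _) qx.
apply/eqP; rewrite -eqp_monic//.
by rewrite qirr ?neq_ltn ?pirr.1 ?orbT.
Qed.

Lemma irreducible_separable (p : {poly rat}) : irreducible_poly p -> separable_poly p.
Proof.
move=> pirr; rewrite unlock irreducible_poly_coprime//.
have [s1 _] := pirr.
have p0 : p^`() != 0.
  have : p^`()`_(size p).-2 != 0; last by apply: contraNneq => ->; rewrite coef0.
  have sE : (size p).-2.+1 = (size p).-1 by case: (size p) s1 => [|[]].
  rewrite coef_deriv sE mulrn_eq0 -/(lead_coef p) lead_coef_eq0 -size_poly_eq0.
  by case: (size p) s1 => [|[]].
have pn0 : p != 0 by rewrite -size_poly_gt0 ltnW.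
by apply/negP => /(dvdp_leq p0); rewrite leqNgt lt_size_deriv.
Qed.

(** Gauss's lemma: the minimal polynomial divides a monic integral polynomial,
hence it is, up to a scalar, an integral polynomial whose leading coefficient is
a unit. *)
Lemma integer_min_poly (K : numFieldType) (p : {poly rat}) (x : K) :
  is_min_poly p x -> integralOver (intr : int -> K) x ->
  exists2 q : {poly int}, q \is monic & p = intp q.
Proof.
move=> [pm pirr px] [f fm fx].
have : p %| intp f.
  apply: contraT => pNf.
  have : coprimep (ratp p : {poly K}) (ratp (intp f)).
    by rewrite coprimep_map irreducible_poly_coprime.
  by move/coprimep_root => /(_ _ px); rewrite ratp_intp -/(root _ _) fx.
move=> /dvdpP_rat_int[q [a a0 pE] [r fE]].
have : lead_coef q * lead_coef r = 1 by rewrite -lead_coefM -fE (monicP fm).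
move=> qr1; have : lead_coef q \is a intUnitRing.unitz.
  by apply: (@intUnitRing.unitzPl _ (lead_coef r)); rewrite mulrC.
have /eqP := pm; rewrite pE lead_coefZ lead_coef_map_inj//; last exact: intr_inj.
rewrite qualifE /= => alq /orP[] /eqP lq; rewrite lq in alq.
  exists q; first by rewrite monicE lq.
  by rewrite -[a]mulr1 alq scale1r.
exists (- q); first by rewrite monicE lead_coefN lq.
by rewrite rmorphN /= -scaleN1r; congr (_ *: _); rewrite -alq; ring.
Qed.

(** As the minimal polynomial is separable, the product over the set of
conjugates is the product of the roots with multiplicity, so it is the constant
coefficient up to sign. *)
Lemma garsia_min_poly (R : realType) (b : R) : garsia_number b ->
  exists (p : {poly int}) (rs : seq R[i]),
    [/\ p \is monic, irreducible_poly (intp p : {poly rat}), `|p`_0| = 2,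
       \prod_(z <- rs) `|z| = 2 &
       [/\ intp p = \prod_(z <- rs) ('X - z%:P), b%:C%C \in rs &
           forall z, z \in rs -> 1 < `|z|]].
Proof.
move=> [b0 bint bnorm bconj].
have [f fm fb] := bint.
have [p0 p0min] : exists p, is_min_poly p b.
  apply: (@exists_min_poly _ (intp f)); last by rewrite ratp_intp.
  by rewrite map_poly_eq0_id0 ?monic_neq0// (monicP fm) rmorph1 oner_neq0.
have [p pm p0E] := integer_min_poly p0min bint.
move: p0min; rewrite {}p0E {p0} => pmin.
have [_ pirr pb] := pmin.
have [rs pE] := closed_field_poly_normal (intp p : {poly R[i]}).
rewrite (monicP (monic_map _ pm)) scale1r in pE.
have urs : uniq rs.
  rewrite -separable_prod_XsubC -pE -ratp_intp separable_map.
  exact: irreducible_separable.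
have conjE : conjugates b = [set` rs].
  apply/seteqP; split => z /=.
    move=> [q qmin qz]; rewrite -root_prod_XsubC -pE.
    by rewrite -(ratp_intp R[i]) (min_poly_uniq pmin qmin).
  rewrite -root_prod_XsubC -pE => pz; exists (intp p) => //.
  by rewrite ratp_intp.
have brs : b%:C%C \in rs.
  rewrite -root_prod_XsubC -pE.
  have -> : intp p = map_poly (real_complex R) (intp p).
    by rewrite -map_poly_comp; apply: eq_map_poly => x /=; rewrite rmorph_int.
  by rewrite fmorph_root -(ratp_intp R).
have normE : galois_norm b = \prod_(z <- rs) z.
  by rewrite /galois_norm conjE -fsbig_seq.
have normE2 : \prod_(z <- rs) `|z| = 2.
  by rewrite -normr_prod -normE; case: bnorm => ->; rewrite ?normrN normr_nat.
exists p, rs; split => //; last first.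
  by split => // z zrs; apply: bconj; rewrite conjE.
apply: (@intr_inj R[i]); rewrite intr_norm.
have -> : (p`_0)%:~R = (intp p : {poly R[i]}).[0] by rewrite horner_coef0 coef_map.
rewrite pE horner_prod [RHS](_ : _ = 2)// -normE2 normr_prod.
by apply: eq_bigr => z _; rewrite hornerXsubC sub0r normrN.
Qed.

(** If [Q] vanishes at [z] then [p] divides [Q], so the constant coefficient of
[Q] is even, hence zero; dividing [Q] by ['X] and starting again kills all the
coefficients. *)
Lemma horner_small_neq0 (K : numFieldType) (p Q : {poly int}) (z : K) :
  p \is monic -> irreducible_poly (intp p : {poly rat}) -> `|p`_0| = 2 ->
  root (intp p) z -> Q != 0 -> (forall i, `|Q`_i| <= 1) -> (intp Q).[z] != 0.
Proof.
move=> pm pirr p02 pz.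
have z0 : z != 0.
  apply: contraPneq pz => ->; rewrite /root horner_coef0 coef_map intr_eq0.
  by rewrite -normr_eq0 p02.
have [n] := ubnP (size Q); elim: n Q => // n IH Q /ltnSE sQ Q0 Qle.
apply/negP => Qz.
have Q00 : Q`_0 = 0.
  have : intp p %| (intp Q : {poly rat}).
    apply: contraT => pNQ.
    have : coprimep (ratp (intp p) : {poly K}) (ratp (intp Q)).
      by rewrite coprimep_map irreducible_poly_coprime.
    by move/coprimep_root => /(_ z); rewrite !ratp_intp Qz => /(_ pz).
  rewrite dvdp_rat_int => /dvdpP_int[r]; rewrite zprimitive_monic// => QE.
  have := Qle 0; rewrite QE coef0M normrM p02.
  have [->|r0] := eqVneq r`_0 0; first by rewrite !mulr0.
  have : 1 <= `|r`_0| by rewrite -gtz0_ge1 normr_gt0.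
  lia.
have QE : Q = drop_poly 1 Q * 'X.
  apply/polyP => -[|i]; first by rewrite coefMX.
  by rewrite coefMX coef_drop_poly addn1.
have dQ0 : drop_poly 1 Q != 0 by apply: contra_neq Q0 => d0; rewrite QE d0 mul0r.
apply: (negP (IH (drop_poly 1 Q) _ dQ0 _)).
- rewrite size_drop_poly; apply: leq_trans sQ.
  by rewrite subn1 prednK// size_poly_gt0.
- by move=> i; rewrite coef_drop_poly.
- by move: Qz; rewrite {1}QE rmorphM/= map_polyX hornerMX mulf_eq0 (negbTE z0) orbF.
Qed.

Lemma ler_norm_horner_small (K : numFieldType) (Q : {poly int}) (n : nat) (z : K) :
  1 < `|z| -> (size Q <= n)%N -> (forall i, `|Q`_i| <= 1) ->
  `|(intp Q).[z]| <= `|z| ^+ n / (`|z| - 1).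
Proof.
move=> z1 sQ Qle.
have sQ' : (size (intp Q : {poly K}) <= n)%N by apply: leq_trans (size_poly _ _) sQ.
rewrite (horner_coef_wide _ sQ') (le_trans (ler_norm_sum _ _ _))//.
apply: (@le_trans _ _ (\sum_(i < n) `|z| ^+ i)).
  apply: ler_sum => i _; rewrite normrM normrX coef_map /= ler_piMl ?exprn_ge0//.
  by rewrite -intr_norm -[1]/(1%:~R) ler_int.
rewrite ler_pdivlMr ?subr_gt0// mulrC -subrX1 lerBlDr lerDl ler01 //.
Qed.

(** The constant is the product of the [|z| - 1] over the conjugates [z] other
than [b]. *)
Lemma garsia_horner_lower_bound (R : realType) (b : R) : garsia_number b ->
  exists2 C : R, 0 < C & forall (n : nat) (Q : {poly int}), Q != 0 -> (size Q <= n)%N ->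
    (forall i, `|Q`_i| <= 1) -> C * (b / 2) ^+ n <= `|(intp Q).[b]|.
Proof.
move=> bG; have [p [rs [pm pirr p02 rs2 [pE brs rs1]]]] := garsia_min_poly bG.
have b0 : 0 < b by case: bG.
pose D : R[i] := \prod_(z <- rem b%:C%C rs) (`|z| - 1).
have D0 : 0 < D.
  rewrite /D big_seq; apply: prodr_gt0 => z /mem_rem zrs; by rewrite subr_gt0 rs1.
have [C DE] : exists C : R, D = C%:C%C.
  exists (complex.Re D); by rewrite RRe_real// gtr0_real.
have C0 : 0 < C by move: D0; rewrite DE ltcR.
exists C => // n Q Q0 sQ Qle.
have [m mE] := prod_root_int Q pm pE.
have m1 : 1 <= `|\prod_(z <- rs) (intp Q).[z]|.
  rewrite mE -intr_norm -[1]/(1%:~R) ler_int -gtz0_ge1 normr_gt0.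
  rewrite -(@intr_eq0 R[i]) -mE prodf_seq_neq0; apply/allP => z zrs /=.
  by apply: (horner_small_neq0 pm) => //; rewrite pE root_prod_XsubC.
have normC (x : R) : `|x%:C%C| = `|x|%:C%C :> R[i].
  have [x0|x0] := leP 0 x; first by rewrite !ger0_norm// -[0]/(0%:C%C) lecR.
  by rewrite !ltr0_norm// ?rmorphN// -[0]/(0%:C%C) ltcR.
have bC0 : b%:C%C != 0 :> R[i] by rewrite fmorph_eq0 gt_eqF.
have norms : \prod_(z <- rem b%:C%C rs) `|z| = (2 / b)%:C%C.
  move: rs2; rewrite (perm_big _ (perm_to_rem brs)) big_cons /= normC gtr0_norm//.
  by move=> bprod; rewrite fmorph_div rmorph_nat -bprod mulrAC divff ?mul1r.
rewrite normr_prod (perm_big _ (perm_to_rem brs)) big_cons /= in m1.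
have {}m1 : 1 <= `|(intp Q).[b%:C%C]| * ((2 / b)%:C%C ^+ n / D).
  apply: le_trans m1 _; rewrite ler_wpM2l//.
  rewrite -norms -prodrXl /D -prodf_div.
  rewrite !big_seq; apply: ler_prod => z /mem_rem zrs.
  rewrite normr_ge0 /=; apply: ler_norm_horner_small => //; exact: rs1.
have Qb : (intp Q).[b%:C%C] = ((intp Q).[b])%:C%C :> R[i].
  rewrite -horner_map /= -map_poly_comp; congr (_.[_]).
  by apply: eq_map_poly => x /=; rewrite rmorph_int.
move: m1; rewrite Qb normC DE -rmorphXn -fmorph_div -rmorphM -[1]/(1%:C%C) lecR.
rewrite mulrA ler_pdivlMr// mul1r => CQ.
rewrite -[b / 2]invf_div exprVn -ler_pdivlMr ?invrK// invr_gt0 exprn_gt0//.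
by rewrite divr_gt0.
Qed.

(** * Finite words and their values *)

Fixpoint wsum (R : realType) (b : R) (w : seq bool) : R :=
  if w is d :: w' then (d%:R + wsum b w') / b else 0.

Lemma wsum_cat (R : realType) (b : R) (u v : seq bool) :
  wsum b (u ++ v) = wsum b u + wsum b v / b ^+ size u.
Proof.
elim: u => [|d u IH] /=; first by rewrite add0r expr0 invr1 mulr1.
by rewrite IH addrA mulrDl exprSr invfM mulrA.
Qed.

Lemma wsum_ge0 (R : realType) (b : R) (w : seq bool) : 0 < b -> 0 <= wsum b w.
Proof.
by move=> b0; elim: w => //= d w IH; rewrite divr_ge0 ?addr_ge0// ltW.
Qed.

Lemma wsum_le (R : realType) (b : R) (w : seq bool) : 1 < b -> wsum b w <= 1 / (b - 1).
Proof.
move=> b1; have b0 : 0 < b by lra.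
have b10 : 0 < b - 1 by lra.
elim: w => [|d w IH] /=; first by rewrite divr_ge0// ltW.
rewrite ler_pdivrMr//.
have -> : 1 / (b - 1) * b = 1 + 1 / (b - 1) by field; rewrite gt_eqF.
by rewrite lerD// lern1 leq_b1.
Qed.

Definition words (n : nat) : seq (seq bool) := [seq tval t | t : n.-tuple bool].

Lemma size_words n : size (words n) = (2 ^ n)%N.
Proof. by rewrite size_map -cardE card_tuple card_bool. Qed.

Lemma words_uniq n : uniq (words n).
Proof. by rewrite map_inj_uniq ?enum_uniq//; exact: val_inj. Qed.

Lemma mem_words n w : (w \in words n) = (size w == n).
Proof.
apply/mapP/eqP => [[t _ ->]|wn]; first exact: size_tuple.
by have /eqP wn' := wn; exists (Tuple wn'); rewrite ?mem_enum.
Qed.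

(** Clearing denominators, [b ^+ size w * wsum b w] is the value at [b] of the
polynomial whose coefficients are the digits of [w], the last digit coming
first. *)
Definition word_poly (w : seq bool) : {poly int} := Poly [seq d%:R | d : bool <- rev w].

Lemma coef_word_poly w i : (word_poly w)`_i = (nth false (rev w) i)%:R.
Proof.
rewrite coef_Poly; have [iw|wi] := ltnP i (size (rev w)).
  by rewrite (nth_map false).
by rewrite !nth_default// size_map.
Qed.

Lemma horner_word_poly (R : realType) (b : R) (w : seq bool) : b != 0 ->
  (map_poly intr (word_poly w)).[b] = b ^+ size w * wsum b w.
Proof.
move=> b0; elim: w => [|d w IH] /=; first by rewrite mulr0 /word_poly /= map_poly0 horner0.
have -> : word_poly (d :: w) = word_poly w + d%:R *: 'X^(size w).
  apply/polyP => i; rewrite coefD coefZ coefXn !coef_word_poly rev_cons nth_rcons size_rev.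
  have [iw|iw|->] := ltngtP i (size w); rewrite ?mulr0 ?addr0 ?mulr1//.
    by rewrite nth_default ?size_rev// ltnW.
  by rewrite nth_default ?size_rev ?add0r.
rewrite rmorphD /= hornerD IH map_polyZ map_polyXn hornerZ hornerXn rmorph_nat.
by rewrite exprS; field.
Qed.

(** The difference of the polynomials of two distinct words has its
coefficients in [{-1, 0, 1}]. *)
Lemma garsia_separation (R : realType) (b : R) : garsia_number b ->
  exists2 C : R, 0 < C & forall u v : seq bool, size u = size v -> u != v ->
    C / 2 ^+ size u <= `|wsum b u - wsum b v|.
Proof.
move=> bG; have [C C0 Cle] := garsia_horner_lower_bound bG.
have b0 : 0 < b by case: bG.
have bn0 : b != 0 by rewrite gt_eqF.
exists C => // u v uv neq_uv.
have := Cle (size u) (word_poly u - word_poly v) _ _ _.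
rewrite rmorphB /= hornerD hornerN !horner_word_poly// -uv -mulrBr normrM.
rewrite (gtr0_norm (exprn_gt0 _ b0)) expr_div_n mulrCA ler_pM2l ?exprn_gt0//; apply.
- apply: contra_neq neq_uv => /subr0_eq uvE.
  apply: (can_inj revK); apply: (@eq_from_nth _ false); rewrite ?size_rev// => i _.
  have := congr1 (fun p : {poly int} => p`_i) uvE; rewrite !coef_word_poly.
  by case: (nth _ _ i); case: (nth _ _ i).
- rewrite (leq_trans (size_polyD _ _))// size_polyN geq_max.
  by rewrite !(leq_trans (size_Poly _))// size_map size_rev ?uv.
- move=> i; rewrite coefB !coef_word_poly.
  by case: (nth _ _ i); case: (nth _ _ i).
Qed.

(** Cut the interval into cells of length [d]: the cell index is injective on
[s]. *)
Lemma separated_count (R : realType) (T : eqType) (s : seq T) (f : T -> R) (a l d : R) :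
  0 < d -> 0 <= l -> uniq s ->
  (forall x y, x \in s -> y \in s -> x != y -> d <= `|f x - f y|) ->
  (forall x, x \in s -> a <= f x <= a + l) ->
  (size s)%:R <= l / d + 1.
Proof.
move=> d0 l0 us sep fs.
pose g x := Num.truncn ((f x - a) / d).
have gE x : x \in s -> (g x)%:R <= (f x - a) / d < (g x).+1%:R.
  by move=> /fs /andP[ax _]; apply: truncn_itv; rewrite divr_ge0 ?subr_ge0// ltW.
have ginj : {in s &, injective g}.
  move=> x y xs ys gxy; apply/eqP; apply: contraT => /(sep _ _ xs ys).
  rewrite leNgt => /negP[]; have := gE _ xs; have := gE _ ys; rewrite gxy.
  rewrite !ler_pdivlMr// !ltr_pdivrMr// -natr1 mulrDl mul1r => /andP[? ?] /andP[? ?].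
  by rewrite ltr_norml; apply/andP; split; lra.
have : (size (map g s) <= size (iota 0 (Num.truncn (l / d)).+1))%N.
  apply: uniq_leq_size; first by rewrite map_inj_in_uniq.
  move=> _ /mapP[x xs ->]; rewrite mem_iota add0n ltnS.
  apply: le_truncn; rewrite ler_pM2r ?invr_gt0//.
  by have /andP[_] := fs _ xs; lra.
rewrite size_map size_iota -(ler_nat R) => /le_trans; apply.
by rewrite -natr1 lerD2r truncn_le divr_ge0// ltW.
Qed.

(** * A second moment inequality *)

Section second_moment.
Context d (T : measurableType d) (R : realType) (mu : {measure set T -> \bar R}).
Local Open Scope ereal_scope.

(** Integrate the pointwise inequality [2 t S <= S^2 + t^2 \1_U], where [S] is
the sum of the indicators of the [A i], which vanishes outside [U]. This form of
the Cauchy-Schwarz bound for the measure of a union leaves [t] to be chosen. *)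
Lemma second_moment (I : eqType) (s : seq I) (A : I -> set T) (U : set T) (t : R) :
  (0 <= t)%R -> measurable U -> (forall i, i \in s -> measurable (A i)) ->
  (forall i, i \in s -> A i `<=` U) ->
  (2 * t)%:E * \sum_(i <- s) mu (A i) <=
  \sum_(i <- s) \sum_(j <- s) mu (A i `&` A j) + (t ^+ 2)%:E * mu U.
Proof.
move=> t0 mU; wlog sA : A / forall i, measurable (A i) /\ A i `<=` U.
  move=> wlogA mA AU; pose A' i := if i \in s then A i else set0.
  have A'E i : i \in s -> A i = A' i by rewrite /A' => ->.
  have -> : \sum_(i <- s) mu (A i) = \sum_(i <- s) mu (A' i).
    by apply: eq_big_seq => i /A'E ->.
  have -> : \sum_(i <- s) \sum_(j <- s) mu (A i `&` A j) =
            \sum_(i <- s) \sum_(j <- s) mu (A' i `&` A' j).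
    by apply: eq_big_seq => i /A'E ->; apply: eq_big_seq => j /A'E ->.
  have sA' i : measurable (A' i) /\ A' i `<=` U.
    by rewrite /A'; case: ifPn => [si|_]; split;
      [exact: mA|exact: AU|exact: measurable0|exact: sub0set].
  by apply: wlogA => // i _; have [] := sA' i.
move=> _ _.
have intE (B : set T) : measurable B -> mu B = \int[mu]_x (\1_B x)%:E.
  by move=> mB; rewrite integral_indic// setIT.
have mi (B : set T) : measurable B -> measurable_fun setT (EFin \o (\1_B : T -> R)).
  by move=> mB; apply/measurable_EFinP; exact: measurable_indic.
have i0 (B : set T) x : 0 <= (\1_B x : R)%:E by rewrite lee_fin.
have mA i : measurable (A i) by have [] := sA i.
have mAA i j : measurable (A i `&` A j) by exact: measurableI.
have lhsE : \sum_(i <- s) mu (A i) = \int[mu]_x \sum_(i <- s) (\1_(A i) x)%:E.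
  rewrite ge0_integral_sum//; last by move=> i; exact: mi.
  by apply: eq_bigr => i _; rewrite intE.
have rhsE : \sum_(i <- s) \sum_(j <- s) mu (A i `&` A j) =
    \int[mu]_x \sum_(i <- s) \sum_(j <- s) (\1_(A i `&` A j) x)%:E.
  rewrite ge0_integral_sum//; last 2 first.
  - by move=> i; apply: emeasurable_sum => j; exact: mi.
  - by move=> i x _; rewrite sume_ge0.
  apply: eq_bigr => i _; rewrite ge0_integral_sum//; last by move=> j; exact: mi.
  by apply: eq_bigr => j _; rewrite intE.
rewrite lhsE rhsE intE// -!ge0_integralZl//; first last.
- by rewrite lee_fin mulr_ge0.
- by move=> x _; rewrite sume_ge0.
- by apply: emeasurable_sum => j; exact: mi.
- by rewrite lee_fin sqr_ge0.
- exact: mi.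
rewrite -ge0_integralD//; first last.
- by apply: measurable_funeM; exact: mi.
- by move=> x _; rewrite mule_ge0// lee_fin sqr_ge0.
- by apply: emeasurable_sum => i; apply: emeasurable_sum => j; exact: mi.
- by move=> x _; rewrite sume_ge0// => i _; rewrite sume_ge0.
apply: ge0_le_integral => //.
- by move=> x _; rewrite mule_ge0 ?lee_fin ?mulr_ge0// sume_ge0.
- by apply: measurable_funeM; apply: emeasurable_sum => j; exact: mi.
- apply: emeasurable_funD; last by apply: measurable_funeM; exact: mi.
  by apply: emeasurable_sum => i; apply: emeasurable_sum => j; exact: mi.
move=> x _.
rewrite sumEFin; under [X in _ <= X + _]eq_bigr do rewrite sumEFin.
rewrite sumEFin -!EFinM -EFinD lee_fin.
set S := (\sum_(i <- s) _)%R.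
have -> : (\sum_(i <- s) \sum_(j <- s) \1_(A i `&` A j) x = S * S :> R)%R.
  rewrite /S big_distrl /=; apply: eq_bigr => i _; rewrite big_distrr /=.
  by apply: eq_bigr => j _; rewrite indicI.
have [xU|xU] := pselect (U x).
  rewrite [X in (t ^+ 2 * X)%R]indicE mem_set// mulr1 -subr_ge0.
  by rewrite (_ : (_ - _ = (S - t) ^+ 2)%R) ?sqr_ge0//; ring.
have -> : S = 0%R.
  rewrite /S big1// => i _; rewrite indicE memNset// => Aix; apply: xU.
  by have [_] := sA i; apply.
by rewrite !mulr0 add0r mulr_ge0// sqr_ge0.
Qed.
End second_moment.

(** * Affine changes of variable for Lebesgue measure *)

Section affine.
Variable R : realType.
Local Notation mu := (@lebesgue_measure R).

Lemma measurable_fun_affine (a k : R) :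
  measurable_fun setT ((fun x => (x - a) * k) : measurableTypeR R -> measurableTypeR R).
Proof.
apply: measurable_funM; last exact: measurable_cst.
by apply: measurable_funB; [exact: measurable_id|exact: measurable_cst].
Qed.

(** The rescaled image of Lebesgue measure under the affine map is a measure
that agrees with Lebesgue measure on half-open intervals. *)
Lemma lebesgue_measure_affine (a k : R) (A : set R) : 0 < k -> measurable A ->
  mu ((fun x => (x - a) * k) @^-1` A) = (k^-1%:E * mu A)%E.
Proof.
move=> k0 mA.
pose f : measurableTypeR R -> measurableTypeR R := fun x => (x - a) * k.
have mf : measurable_fun setT f := measurable_fun_affine a k.
pose nu' := mscale (NngNum (ltW k0)) (pushforward mu f).
pose nu : {measure set (measurableTypeR R) -> \bar R} := nu' mf.
have -> : mu A = nu A.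
  apply: (@lebesgue_measure_unique R nu) => // _ [[c d] _ <-].
  rewrite /nu /nu' /= /mscale /pushforward /=.
  rewrite -[pushforward _ _ _]/(mu (f @^-1` `]c, d]%classic)).
  have -> : f @^-1` `]c, d]%classic = `]c / k + a, d / k + a]%classic.
    apply/seteqP; split => x /=; rewrite !in_itv /= -ltrBrDr -lerBlDr.
      by rewrite ltr_pdivrMr// ler_pdivlMr.
    by rewrite ltr_pdivrMr// ler_pdivlMr.
  rewrite !lebesgue_measure_itv /= !lte_fin ltrD2r ltr_pM2r ?invr_gt0//.
  case: ifPn => _; last by rewrite mule0.
  by rewrite -EFinD -EFinM; congr (_%:E); field; rewrite gt_eqF.
rewrite /nu /nu' /mscale /= muleA -EFinM mulVf ?gt_eqF// mul1e.
by [].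
Qed.

Lemma negligible_affine (a k : R) (A : set R) : 0 < k -> mu.-negligible A ->
  mu.-negligible ((fun x => (x - a) * k) @^-1` A).
Proof.
move=> k0 [B [mB B0 AB]]; exists ((fun x => (x - a) * k) @^-1` B); split.
- by rewrite -[X in measurable X]setTI; exact: (measurable_fun_affine a k).
- by rewrite lebesgue_measure_affine// B0 mule0.
- exact: preimage_subset.
Qed.
End affine.

(** * The approximation radius *)

(** The shift by [2] keeps the terms positive and decreasing from [n = 0] on. *)
Definition log_harmonic (R : realType) (n : nat) : R := (n.+2%:R * ln n.+2%:R)^-1.

Section log_harmonic.
Variable R : realType.
Local Notation a := (@log_harmonic R).

Lemma ln_le_subr1 (x : R) : 0 < x -> ln x <= x - 1.
Proof. by move=> x0; have := @le_ln1Dx R (x - 1); rewrite addrCA subrr addr0; apply; lra. Qed.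

Lemma ln_nat2_gt0 n : 0 < ln n.+2%:R :> R.
Proof. by rewrite ln_gt0// (ltr_nat _ 1). Qed.

Lemma log_harmonic_gt0 n : 0 < a n.
Proof. by rewrite invr_gt0 mulr_gt0// ln_nat2_gt0. Qed.

Lemma log_harmonic_le m n : (m <= n)%N -> a n <= a m.
Proof.
move=> mn; rewrite /log_harmonic lef_pV2 ?posrE ?mulr_gt0 ?ln_nat2_gt0//.
by apply: ler_pM; rewrite ?ler_nat ?ler_ln ?posrE ?ler_nat// ltW ?ln_nat2_gt0.
Qed.

Lemma log_harmonic_le1 n : a n <= 1.
Proof.
apply: le_trans (log_harmonic_le (leq0n n)) _.
have l2 : 1 / 2 <= ln 2 :> R.
  have : ln (2^-1) <= 2^-1 - 1 :> R by rewrite ln_le_subr1.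
  by rewrite lnV ?posrE//; lra.
by rewrite /log_harmonic invf_le1; lra.
Qed.

Lemma log_harmonic_doubling n : a n <= 4 * a n.+1.
Proof.
have l2 := ln_nat2_gt0 n; have l3 := ln_nat2_gt0 n.+1.
rewrite /log_harmonic -[4]invrK -invfM lef_pV2 ?posrE ?mulr_gt0 ?invr_gt0//.
have h1 : n.+3%:R <= 2 * n.+2%:R :> R by rewrite -natrM ler_nat; lia.
have h2 : ln n.+3%:R <= 2 * ln n.+2%:R :> R.
  rewrite mulr_natl -lnXn// ler_ln ?posrE ?exprn_gt0//.
  by rewrite -natrX ler_nat; lia.
have -> : n.+2%:R * ln n.+2%:R = 4^-1 * ((2 * n.+2%:R) * (2 * ln n.+2%:R)) :> R by field.
by rewrite ler_pM2l ?invr_gt0//; apply: ler_pM => //; exact: ltW.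
Qed.

Lemma log_harmonic_le_inv n : (2 <= n)%N -> a n <= 1 / (n%:R * ln n%:R).
Proof.
case: n => [|[|n]]// _; rewrite div1r.
have := log_harmonic_le (leq_addr 2 n); rewrite addnC; exact.
Qed.

(** Telescoping: two uses of [ln u <= u - 1] bound the increment of [ln (ln _)]
by the corresponding term of the sum. *)
Lemma sum_log_harmonic_ge M N :
  ln (ln (M + N).+2%:R) - ln (ln M.+2%:R) <= \sum_(M <= n < M + N) a n.
Proof.
elim: N => [|N IH]; first by rewrite addn0 subrr big_geq.
rewrite addnS big_nat_recr ?leq_addr//=; set n := (M + N)%N in IH *.
have l2 := ln_nat2_gt0 n; have l3 := ln_nat2_gt0 n.+1.
suff : ln (ln n.+3%:R) - ln (ln n.+2%:R) <= a n by lra.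
rewrite -ln_div ?posrE//.
have h1 : ln (ln n.+3%:R / ln n.+2%:R) <= ln n.+3%:R / ln n.+2%:R - 1 :> R.
  by rewrite ln_le_subr1// divr_gt0.
apply: (le_trans h1).
have -> : ln n.+3%:R / ln n.+2%:R - 1 = (ln n.+3%:R - ln n.+2%:R) / ln n.+2%:R :> R.
  by field; rewrite gt_eqF.
rewrite /log_harmonic invfM ler_pM2r ?invr_gt0//.
rewrite -ln_div ?posrE//.
apply: (@le_trans _ _ (n.+3%:R / n.+2%:R - 1)).
  by rewrite ln_le_subr1// divr_gt0.
by rewrite -[n.+3%:R]natr1 mulrDl divff// mul1r addrAC subrr add0r.
Qed.

Lemma sum_log_harmonic_unbounded M (B : R) :
  exists N, B <= \sum_(M <= n < M + N) a n.
Proof.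
pose X := expR (expR (B + ln (ln M.+2%:R))).
exists (Num.truncn X).+1; apply: le_trans (sum_log_harmonic_ge _ _).
rewrite lerBrDr -ler_expR lnK ?posrE ?ln_nat2_gt0// -ler_expR lnK ?posrE//.
by apply: le_trans (ltW (truncnS_gt X)) _; rewrite ler_nat !leqW// leq_addl.
Qed.

End log_harmonic.

Definition radius (R : realType) (n : nat) : R := log_harmonic R n / 2 ^+ n.

Section radius.
Variable R : realType.
Local Notation psi := (@radius R).

Lemma radius_gt0 n : 0 < psi n.
Proof. by rewrite divr_gt0 ?log_harmonic_gt0 ?exprn_gt0. Qed.

Lemma radius_le m n : (m <= n)%N -> psi n <= psi m.
Proof.
move=> mn; apply: ler_pM.
- by rewrite ltW// log_harmonic_gt0.
- by rewrite invr_ge0 exprn_ge0.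
- exact: log_harmonic_le.
- by rewrite lef_pV2 ?posrE ?exprn_gt0// ler_eXn2l ?ltr1n.
Qed.

Lemma radius_le1 n : psi n <= 1 / 2 ^+ n.
Proof. by rewrite /radius ler_pM2r ?invr_gt0 ?exprn_gt0// log_harmonic_le1. Qed.

(** At each step the power of [2] loses a factor [2] and the logarithmic factor
at most [4]. *)
Lemma radius_shift m n : psi m <= 8 ^+ n * psi (n + m).
Proof.
elim: n => [|n IH]; first by rewrite expr0 mul1r.
apply: (le_trans IH); rewrite exprSr -mulrA ler_pM2l ?exprn_gt0// addSn.
rewrite /radius exprS invfM; have := log_harmonic_doubling R (n + m).
set x := log_harmonic _ (n + m); have : 0 < (2 : R) ^- (n + m) by rewrite invr_gt0 exprn_gt0.
by move=> y0 xy; nra.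
Qed.

Lemma radius_le_inv n : (2 <= n)%N -> psi n <= 1 / (n%:R * 2 ^+ n * ln n%:R).
Proof.
move=> n2; have := log_harmonic_le_inv R n2.
rewrite /radius -(@ler_pM2r _ (2 ^- n)) ?invr_gt0 ?exprn_gt0// => /le_trans; apply.
by rewrite !div1r -invfM mulrAC.
Qed.
End radius.

(** * Overlaps of the approximation intervals *)

(** The factor [c] will tend to [0]; this slack is what makes the limit set stable
under contractions. *)
Definition near_word (R : realType) (b c : R) (w : seq bool) : set R :=
  `[wsum b w, wsum b w + c * radius R (size w)]%classic.

Section overlaps.
Variables (R : realType) (b C : R).
Hypotheses (C0 : 0 < C)
  (sepC : forall u v : seq bool, size u = size v -> u != v ->
            C / 2 ^+ size u <= `|wsum b u - wsum b v|).
Local Notation mu := (@lebesgue_measure R).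
Local Notation psi := (@radius R).

Lemma measurable_near_word c w : measurable (near_word b c w).
Proof. exact: measurable_itv. Qed.

Lemma mu_near_word c w : 0 <= c -> mu (near_word b c w) = (c * psi (size w))%:E.
Proof.
move=> c0; rewrite /near_word lebesgue_measure_itv /= lte_fin ltrDl.
have [->|cn0] := eqVneq c 0; first by rewrite mul0r ltxx.
rewrite pmulr_rgt0 ?radius_gt0 ?lt0r ?cn0 ?c0//.
by rewrite -EFinD addrAC subrr add0r.
Qed.

(** Only words whose value lies within [c * psi (size u)] of that of [u] can
contribute, and separation bounds their number. *)
Lemma sum_overlap_le c u m : 0 <= c -> (size u <= m)%N ->
  (\sum_(v <- words m) mu (near_word b c u `&` near_word b c v) <=
   (c * psi m * (2 * (c * psi (size u)) / (C / 2 ^+ m) + 1))%:E)%E.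
Proof.
move=> c0 um; set n := size u.
have r0 k : 0 <= c * psi k by rewrite mulr_ge0// ltW// radius_gt0.
pose close v := `|wsum b v - wsum b u| <= c * psi n.
rewrite (bigID close) /= [X in (_ + X)%E]big1_seq ?adde0; last first.
  move=> v /andP[vNu]; rewrite mem_words => /eqP vm.
  rewrite (_ : _ `&` _ = set0) ?measure0//.
  apply/seteqP; split => // x; rewrite /near_word /= !in_itv /= -/n vm.
  move=> [/andP[ux xu] /andP[vx xv]]; move/negP: vNu; apply.
  have rr : c * psi m <= c * psi n by rewrite ler_wpM2l// radius_le.
  by rewrite /close ler_norml; apply/andP; split; lra.
apply: (@le_trans _ _ (\sum_(v <- words m | close v) (c * psi m)%:E)%E).
  rewrite big_seq_cond [X in (_ <= X)%E]big_seq_cond.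
  apply: lee_sum => v /andP[]; rewrite mem_words => /eqP vm _.
  have <- : mu (near_word b c v) = (c * psi m)%:E by rewrite mu_near_word// vm.
  by apply: le_measure; rewrite ?inE//; [apply: measurableI|]; exact: measurable_near_word.
rewrite sumEFin lee_fin -big_filter big_const_seq count_predT iter_addr_0 -[leLHS]mulr_natr.
rewrite ler_wpM2l//.
apply: (@separated_count _ _ _ (wsum b) (wsum b u - c * psi n)).
- by rewrite divr_gt0// exprn_gt0.
- by rewrite mulr_ge0.
- by rewrite filter_uniq// words_uniq.
- move=> x y; rewrite !mem_filter !mem_words => /andP[_ /eqP xm] /andP[_ /eqP ym] xy.
  by rewrite -xm; apply: sepC => //; rewrite xm.
- move=> x; rewrite mem_filter /close ler_norml => /andP[/andP[? ?] _].
  by apply/andP; split; lra.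
Qed.

Lemma sum_overlap_words_le c n m : 0 <= c -> (n <= m)%N ->
  (\sum_(u <- words n) \sum_(v <- words m) mu (near_word b c u `&` near_word b c v) <=
   (2 / C * (c * log_harmonic R n * (c * log_harmonic R m)) +
    c * log_harmonic R m * (2 ^+ n / 2 ^+ m))%:E)%E.
Proof.
move=> c0 nm.
apply: (@le_trans _ _ (\sum_(u <- words n)
   (c * psi m * (2 * (c * psi n) / (C / 2 ^+ m) + 1))%:E)%E).
  rewrite big_seq [X in (_ <= X)%E]big_seq.
  apply: lee_sum => u; rewrite mem_words => /eqP un.
  by have := sum_overlap_le c0 (_ : (size u <= m)%N); rewrite un; apply.
rewrite sumEFin lee_fin big_const_seq count_predT iter_addr_0 size_words.
rewrite -[leLHS]mulr_natr natrX /radius.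
have p k : (2 : R) ^+ k != 0 by rewrite expf_neq0.
by rewrite le_eqVlt; apply/orP; left; apply/eqP; field; rewrite !p gt_eqF.
Qed.

(** The geometric sum that makes the boundary terms of the overlaps negligible:
they decay exponentially in the difference of the two lengths. *)
Lemma sum_pow2_le (j m N : nat) :
  (\sum_(j <= n < j + N) (if n <= m then 2 ^ n else 0) <= 2 ^ m.+1)%N.
Proof.
(* The minimum doubles exactly at the steps that add a term. *)
suff : (\sum_(j <= n < j + N) (if n <= m then 2 ^ n else 0) <= 2 ^ (minn (j + N) m.+1))%N.
  by move/leq_trans; apply; rewrite leq_exp2l// geq_minr.
elim: N => [|N IH]; first by rewrite addn0 big_geq.
rewrite addnS big_nat_recr ?leq_addr//=; case: ifPn => jNm.
  have -> : minn (j + N).+1 m.+1 = (j + N).+1 by apply/minn_idPl.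
  rewrite expnS mul2n -addnn leq_add2r (leq_trans IH)//.
  by rewrite leq_exp2l// geq_minl.
rewrite addn0 (leq_trans IH)// leq_exp2l//; lia.
Qed.

Definition word_range j N : seq (seq bool) :=
  [seq w | n <- iota j N, w <- words n].

Lemma big_word_range (T : Type) (x0 : T) (op : Monoid.law x0) j N (F : seq bool -> T) :
  \big[op/x0]_(w <- word_range j N) F w =
  \big[op/x0]_(j <= n < j + N) \big[op/x0]_(w <- words n) F w.
Proof. by rewrite big_allpairs_dep /index_iota addKn. Qed.

(** The bound [C / 4] does not depend on [c] nor on [j], since divergence lets the
total length [A] of the intervals exceed any bound; this uniformity is the whole
point. The second moment inequality is used with [t = 4 A / C]. *)
Lemma mu_union_near_words c j : 0 < c -> forall U : set R, measurable U ->
  (forall w, (j <= size w)%N -> near_word b c w `<=` U) -> ((C / 4)%:E <= mu U)%E.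
Proof.
move=> c0 U mU subU.
pose al k := c * log_harmonic R k.
have al0 k : 0 <= al k by rewrite mulr_ge0// ltW// log_harmonic_gt0.
have [N AN] := sum_log_harmonic_unbounded j (2 * C / c).
pose A := \sum_(j <= n < j + N) al n.
have A2C : 2 * C <= A by rewrite /A -mulr_sumr [leRHS]mulrC -ler_pdivrMr.
pose W := word_range j N.
have muW : (\sum_(w <- W) mu (near_word b c w) = A%:E)%E.
  rewrite big_word_range /A -sumEFin; apply: eq_bigr => n _.
  rewrite (eq_big_seq (fun=> (c * psi n)%:E)); last first.
    by move=> w; rewrite mem_words => /eqP <-; rewrite mu_near_word// ltW.
  rewrite sumEFin; congr (_%:E).
  rewrite big_const_seq count_predT iter_addr_0 size_words -mulr_natr natrX.
  by rewrite /radius /al mulrA divfK// expf_neq0.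
(* [h] comes from the [+ 1] in the count of nearby words; which of the two
   lengths is the larger decides the order of its arguments. *)
pose h n m : R := if (n <= m)%N then 2 ^+ n / 2 ^+ m else 0.
have h0 n m : 0 <= h n m by rewrite /h; case: ifPn => // _; rewrite divr_ge0 ?exprn_ge0.
have muWW : (\sum_(u <- W) \sum_(v <- W) mu (near_word b c u `&` near_word b c v) <=
   (4 / C * A ^+ 2)%:E)%E.
  rewrite big_word_range.
  under eq_bigr do under eq_bigr do rewrite big_word_range.
  under eq_bigr do rewrite exchange_big /=.
  apply: (@le_trans _ _ (\sum_(j <= n < j + N) \sum_(j <= m < j + N)
     (2 / C * (al n * al m) + al m * h n m + al n * h m n)%:E)%E).
    apply: lee_sum => n _; apply: lee_sum => m _.
    have [nm|/ltnW mn] := leqP n m.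
      apply: (le_trans (sum_overlap_words_le (ltW c0) nm)); rewrite lee_fin.
      by rewrite {1}/h nm lerDl mulr_ge0.
    rewrite exchange_big /=; under eq_bigr do under eq_bigr do rewrite setIC.
    apply: (le_trans (sum_overlap_words_le (ltW c0) mn)); rewrite lee_fin.
    by rewrite {2}/h mn [al m * al n]mulrC addrAC lerDl mulr_ge0.
  under eq_bigr do rewrite sumEFin.
  rewrite sumEFin lee_fin.
  have hsum m : \sum_(j <= n < j + N) h n m <= 2.
    have -> : \sum_(j <= n < j + N) h n m =
       (\sum_(j <= n < j + N) (if n <= m then 2 ^ n else 0))%N%:R / 2 ^+ m.
      rewrite natr_sum mulr_suml; apply: eq_bigr => n _; rewrite /h.
      by case: ifPn; rewrite ?natrX ?mul0r.
    by rewrite ler_pdivrMr ?exprn_gt0// -exprS -natrX ler_nat sum_pow2_le.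
  have alsum : \sum_(j <= m < j + N) al m * (\sum_(j <= n < j + N) h n m) <= 2 * A.
    rewrite mulrC /A mulr_suml; apply: ler_sum => m _.
    by rewrite ler_wpM2l.
  have -> : \sum_(j <= n < j + N) \sum_(j <= m < j + N)
      (2 / C * (al n * al m) + al m * h n m + al n * h m n) =
     2 / C * A ^+ 2 + 2 * \sum_(j <= m < j + N) al m * (\sum_(j <= n < j + N) h n m).
    under eq_bigr do rewrite !big_split /=.
    rewrite !big_split /= -addrA [X in _ = _ + X]mulr_natl mulr2n; congr (_ + (_ + _)).
    - rewrite expr2 /A mulr_suml mulr_sumr; apply: eq_bigr => n _.
      by rewrite !mulr_sumr; apply: eq_bigr => m _.
    - by rewrite exchange_big /=; apply: eq_bigr => m _; rewrite mulr_sumr.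
    - by apply: eq_bigr => m _; rewrite mulr_sumr.
  have A0 : 0 < A by apply: lt_le_trans A2C; rewrite mulr_gt0.
  have : 4 * A <= 2 / C * A ^+ 2.
    have -> : 4 * A = 2 / C * ((2 * C) * A) by field; rewrite gt_eqF.
    by rewrite ler_pM2l ?divr_gt0// expr2 ler_pM2r.
  have -> : 4 / C * A ^+ 2 = 2 / C * A ^+ 2 + 2 / C * A ^+ 2 by field; rewrite gt_eqF.
  lra.
have A0 : 0 < A by apply: lt_le_trans A2C; rewrite mulr_gt0.
have t0 : 0 <= 4 / C * A by rewrite mulr_ge0// ?divr_ge0// ltW.
have := second_moment mu t0 mU (s := W) (A := near_word b c) _ _.
rewrite muW => /(_ (fun w _ => measurable_near_word c w)).
have WU w : w \in W -> near_word b c w `<=` U.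
  move=> /allpairsPdep[n [v [nj vn ->]]]; apply: subU.
  by move: nj vn; rewrite mem_iota mem_words => /andP[jn _] /eqP ->.
move=> /(_ WU) muU.
have {muU} : ((2 * (4 / C * A))%:E * A%:E <=
    (4 / C * A ^+ 2)%:E + ((4 / C * A) ^+ 2)%:E * mu U)%E.
  exact: le_trans muU (leeD muWW (lexx _)).
have [Ufin|] := boolP (mu U \is a fin_num); last first.
  by rewrite ge0_fin_numE// -leNgt leye_eq => /eqP->; rewrite leey.
rewrite -(fineK Ufin); set x := fine _.
rewrite -!EFinM -EFinD !lee_fin => H.
have : 0 <= (4 / C * A) ^+ 2 * (x - C / 4).
  have -> : (4 / C * A) ^+ 2 * (x - C / 4) =
    4 / C * A ^+ 2 + (4 / C * A) ^+ 2 * x - 2 * (4 / C * A) * A by field; rewrite gt_eqF.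
  by rewrite subr_ge0.
by rewrite pmulr_rge0 ?subr_ge0// exprn_gt0// mulr_gt0// divr_gt0.
Qed.

End overlaps.

(** * The set of well approximable points *)

(** The index [j] both bounds the error by [1 / j.+1] times the radius and forces
words of length at least [j]: a single decreasing intersection asks for
infinitely many approximations with arbitrarily small factors. *)
Definition well_approx (R : realType) (b : R) : set R :=
  \bigcap_j \bigcup_(w in [set w | (j <= size w)%N]) near_word b (j.+1%:R^-1) w.

Section well_approx.
Variables (R : realType) (b : R).
Hypotheses (b1 : 1 < b) (b2 : b < 2).
Local Notation mu := (@lebesgue_measure R).
Local Notation psi := (@radius R).
Local Notation V := (well_approx b).
Local Notation L := (1 / (b - 1)).
Let U j : set R := \bigcup_(w in [set w | (j <= size w)%N]) near_word b (j.+1%:R^-1) w.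

Let b0 : 0 < b. Proof. exact: lt_trans b1. Qed.
Let L0 : 0 < L. Proof. by rewrite divr_gt0// subr_gt0. Qed.

Lemma near_wordP c w x :
  near_word b c w x <-> 0 <= x - wsum b w <= c * psi (size w).
Proof. by rewrite /near_word /= in_itv /= subr_ge0 lerBlDl. Qed.

Lemma well_approxP x : V x <-> forall j : nat, exists w : seq bool,
  (j <= size w)%N /\ 0 <= x - wsum b w <= j.+1%:R^-1 * psi (size w).
Proof.
split=> [Vx j|Vx j _].
  by have [w jw /near_wordP xw] := Vx j I; exists w.
by have [w [jw xw]] := Vx j; exists w => //; apply/near_wordP.
Qed.

Let measurable_U j : measurable (U j).
Proof.
rewrite /U bigcup_mkcond; apply: countable_bigcupT_measurable => [|w].
  exact: countableP.
by case: ifP => _; [exact: measurable_near_word|exact: measurable0].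
Qed.

Lemma measurable_well_approx : measurable V.
Proof. by apply: bigcapT_measurable => j; exact: measurable_U. Qed.

Let U_noninc : nonincreasing_seq U.
Proof.
move=> i j ij; apply/subsetPset => x [w /= jw /near_wordP/andP[x0 xw]].
exists w; first by rewrite /= (leq_trans ij).
apply/near_wordP; rewrite x0/= (le_trans xw)// ler_wpM2r//.
  by rewrite ltW// radius_gt0.
by rewrite lef_pV2 ?posrE// ler_nat.
Qed.

Lemma radius_scaled_le (j n : nat) : j.+1%:R^-1 * psi n <= j.+1%:R^-1.
Proof.
rewrite ler_piMr ?invr_ge0// (le_trans (radius_le1 _ _))//.
by rewrite ler_pdivrMr ?exprn_gt0// mul1r exprn_ege1// ler1n.
Qed.

Lemma well_approx_sub : V `<=` beta_interval b.
Proof.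
move=> x /well_approxP Vx; rewrite /beta_interval /= in_itv /=; apply/andP; split.
  have [w [_ /andP[xw _]]] := Vx 0; have := wsum_ge0 w b0; lra.
suff xLe (e : R) : 0 < e -> x <= L + e by apply/ler_addgt0Pr.
move=> e0.
have [j je] : exists j : nat, j.+1%:R^-1 <= e.
  exists (Num.truncn e^-1).
  by rewrite -[leRHS]invrK lef_pV2 ?posrE ?invr_gt0// ltW// truncnS_gt.
have [w [_ /andP[_ xw]]] := Vx j.
have xe : x - wsum b w <= e := le_trans xw (le_trans (radius_scaled_le _ _) je).
have := wsum_le w b1; lra.
Qed.

Lemma mu_well_approx_ge (C : R) : 0 < C ->
  (forall u v : seq bool, size u = size v -> u != v ->
     C / 2 ^+ size u <= `|wsum b u - wsum b v|) ->
  ((C / 4)%:E <= mu V)%E.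
Proof.
move=> C0 sepC.
have cv : mu \o U @ \oo --> mu V.
  apply: nonincreasing_cvg_mu => //; last exact: measurable_well_approx.
  apply: (@le_lt_trans _ _ (mu `[0, L + 1]%classic)).
    apply: le_measure; rewrite ?inE//; first exact: measurable_U.
    move=> x [w _ /near_wordP/andP[x0 xw]]; rewrite /= in_itv /=; apply/andP; split.
      by have := wsum_ge0 w b0; lra.
    have xw1 := le_trans xw (radius_scaled_le 0 (size w)).
    by have := wsum_le w b1; rewrite invr1 in xw1; lra.
  by rewrite lebesgue_measure_itv /=; case: ifPn => _; rewrite -?EFinD ltry.
rewrite -(cvg_lim _ cv)//; apply: lime_ge; first by apply/cvg_ex; exists (mu V).
apply: nearW => j /=.
apply: (mu_union_near_words C0 sepC (c := j.+1%:R^-1) (j := j)) => //.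
by move=> w jw x xw; exists w.
Qed.

(** Prepending [w] may multiply the ratio of the error to the radius by
[8 ^ size w]; since the factor allowed for [x] is arbitrarily small, it can be
chosen to absorb this constant. *)
Lemma well_approx_cat w x : V x -> V (wsum b w + x / b ^+ size w).
Proof.
move=> /well_approxP Vx; apply/well_approxP => j.
(* [8 ^ n] compensates for the loss in [radius_shift]. *)
set n := size w; set j' := (8 ^ n * j.+1)%N.
have [v [jv /andP[xv0 xv]]] := Vx j'.
have jj' : (j <= j')%N.
  by apply: leq_trans (leqnSn j) _; rewrite leq_pmull// expn_gt0.
exists (w ++ v); split.
  by rewrite size_cat (leq_trans jj')// (leq_trans jv)// leq_addl.
have bn1 : 1 <= b ^+ n by rewrite exprn_ege1// ltW.
have bn0 : 0 < b ^+ n by apply: lt_le_trans bn1.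
have -> : wsum b w + x / b ^+ n - wsum b (w ++ v) = (x - wsum b v) / b ^+ n.
  by rewrite wsum_cat mulrBl -/n; ring.
rewrite divr_ge0 ?(ltW bn0)//= ler_pdivrMr//.
apply: le_trans xv _; rewrite size_cat -/n; set m := size v.
apply: (@le_trans _ _ (j.+1%:R^-1 * psi (n + m))); last first.
  by rewrite ler_peMr// mulr_ge0 ?invr_ge0// ltW// radius_gt0.
rewrite -ler_pdivlMl ?invr_gt0// invrK.
apply: (le_trans (radius_shift R m n)).
rewrite [leRHS]mulrA ler_pM2r ?radius_gt0// ler_pdivlMr//.
by rewrite -natrX -natrM ler_nat leqnSn.
Qed.

(** As [b < 2], the images of the interval under the two digit maps cover it. *)
Lemma beta_interval_digit x : beta_interval b x ->
  exists (d : bool) (y : R), beta_interval b y /\ x = (d%:R + y) / b.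
Proof.
rewrite /beta_interval /= in_itv /= => /andP[x0 xL].
have bLE : b * L = 1 + L by field; rewrite gt_eqF// subr_gt0.
have bxL : b * x <= b * L by rewrite ler_pM2l.
have L1 : 1 <= L by rewrite ler_pdivlMr ?subr_gt0// mul1r lerBlDl ltW.
have [bx|bx] := leP (b * x) L.
  exists false, (b * x); split; last by rewrite add0r mulrAC divff ?mul1r// gt_eqF.
  by rewrite in_itv /= bx andbT mulr_ge0// ltW.
exists true, (b * x - 1); split.
  by rewrite in_itv /=; apply/andP; split; lra.
by rewrite addrC subrK mulrAC divff ?mul1r// gt_eqF.
Qed.

Lemma beta_interval_word n x : beta_interval b x -> exists (w : seq bool) (y : R),
  [/\ size w = n, beta_interval b y & x = wsum b w + y / b ^+ n].
Proof.
elim: n x => [|n IH] x Ix.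
  by exists [::], x; split => //=; rewrite add0r expr0 divr1.
have [d [y [Iy ->]]] := beta_interval_digit Ix.
have [w [z [wn Iz ->]]] := IH _ Iy.
exists (d :: w), z; split => //=; first by rewrite wn.
by rewrite exprSr invfM addrA mulrDl mulrA.
Qed.

(** A zero-one law: by self-similarity the density of [V] at any point of the
interval is bounded below along a sequence of radii, so it cannot be [0]. *)
Lemma ae_well_approx : (0 < mu V)%E ->
  {ae mu, forall x, beta_interval b x -> V x}.
Proof.
move=> V0; have mV := measurable_well_approx.
have := lebesgue_density mV.
apply: (@filterS _ _ (ae_filter_ringOfSetsType mu)) => x dens Ix.
apply: contrapT => Vx; move: dens; rewrite indicE memNset//=.
have Vfin : mu V \is a fin_num.
  rewrite ge0_fin_numE//; apply: (@le_lt_trans _ _ (mu `[0, L]%classic)).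
    by apply: le_measure; rewrite ?inE//; exact: well_approx_sub.
  by rewrite lebesgue_measure_itv /=; case: ifPn => _; rewrite -?EFinD ltry.
pose k := fine (mu V).
have k0 : 0 < k by rewrite -lte_fin fineK.
(* A ball of radius [2 L / b ^ n], of measure [4 L / b ^ n], contains a copy of
   [V] of measure [k / b ^ n]. *)
have e0 : 0 < k / (4 * L) by rewrite divr_gt0// mulr_gt0.
move=> /fine_cvgP [_ /cvgrPdist_lt/(_ _ e0)[dl /= dl0 Hdl]].
have [n bn] : exists n, 2 * L / b ^+ n < dl.
  have : (b^-1 : R) ^+ n @[n --> \oo] --> 0.
    by apply: cvg_expr; rewrite gtr0_norm ?invr_gt0// invf_lt1.
  move=> /cvgrPdist_lt/(_ (dl / (2 * L))) []; first by rewrite divr_gt0// mulr_gt0.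
  move=> N _ /(_ N (leqnn _)) /=.
  rewrite sub0r normrN gtr0_norm ?exprn_gt0 ?invr_gt0// exprVn.
  rewrite ltr_pdivlMr; last by apply: mulr_gt0.
  by move=> bN; exists N; rewrite mulrC.
have bn0 : 0 < b ^+ n by rewrite exprn_gt0.
set rho := 2 * L / b ^+ n in bn.
have rho0 : 0 < rho by rewrite divr_gt0// mulr_gt0.
have dist_itv (u v : R) : 0 <= u <= L -> 0 <= v <= L -> `|u - v| < 2 * L.
  move: L L0 => l l0 /andP[? ?] /andP[? ?].
  by rewrite ltr_norml; apply/andP; split; lra.
have [w [y [wn Iy xE]]] := beta_interval_word n Ix.
have sub : (fun z => (z - wsum b w) * b ^+ n) @^-1` V `<=` V `&` ball x rho.
  move=> z /= Vz; have Iz : beta_interval b ((z - wsum b w) * b ^+ n) := well_approx_sub Vz.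
  have zE : z = wsum b w + (z - wsum b w) * b ^+ n / b ^+ n.
    by rewrite mulfK ?gt_eqF//; ring.
  split; first by rewrite zE -{2}wn; exact: well_approx_cat.
  have [v vE] : exists v : R, v = (z - wsum b w) * b ^+ n by eexists.
  rewrite -vE in zE Iz.
  rewrite /ball /= zE xE opprD addrACA subrr add0r -mulrBl.
  rewrite normrM [`|_^-1|]gtr0_norm ?invr_gt0// ltr_pM2r ?invr_gt0//.
  by move: Iy Iz; rewrite /beta_interval /= !in_itv /=; exact: dist_itv.
have mB : measurable (V `&` ball x rho) by apply: measurableI => //; exact: measurable_ball.
have muB : mu (ball x rho) = (rho *+ 2)%:E by rewrite lebesgue_measure_ball// ltW.
have Bfin : mu (V `&` ball x rho) \is a fin_num.
  rewrite ge0_fin_numE//; apply: (@le_lt_trans _ _ (mu (ball x rho))).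
    by apply: le_measure; rewrite ?inE//; exact: measurable_ball.
  by rewrite muB ltry.
have lowB : (b ^+ n)^-1 * k <= fine (mu (V `&` ball x rho)).
  rewrite -lee_fin fineK// EFinM fineK// -(lebesgue_measure_affine (wsum b w))//.
  apply: le_measure; rewrite ?inE//.
  by rewrite -[X in measurable X]setTI; exact: measurable_fun_affine.
have := Hdl rho; rewrite /ball /= sub0r normrN gtr0_norm// => /(_ bn rho0).
rewrite muB -(fineK Bfin) inver mulrn_eq0/= gt_eqF// -EFinM /= sub0r normrN.
rewrite ger0_norm; last first.
  by rewrite mulr_ge0 ?fine_ge0 ?measure_ge0// invr_ge0 mulrn_wge0// ltW.
rewrite ltNge => /negP; apply.
rewrite ler_pdivlMr ?mulrn_wgt0//; apply: le_trans lowB.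
rewrite /rho le_eqVlt; apply/orP; left; apply/eqP; field.
by rewrite !gt_eqF// subr_gt0.
Qed.
End well_approx.

(** * Gluing approximations into one expansion *)

Section expansion.
Variables (R : realType) (b : R).
Hypotheses (b1 : 1 < b) (b2 : b < 2).
Local Notation mu := (@lebesgue_measure R).
Local Notation psi := (@radius R).
Local Notation V := (well_approx b).

Let b0 : 0 < b. Proof. exact: lt_trans b1. Qed.

(** The point that a word [v] has to approximate for [w ++ v] to approximate
[x]. *)
Definition remainder (w : seq bool) (x : R) : R := (x - wsum b w) * b ^+ size w.

Lemma remainder_cat u v x : remainder (u ++ v) x = (remainder u x - wsum b v) * b ^+ size v.
Proof.
rewrite /remainder size_cat exprD mulrA; congr (_ * _).
rewrite wsum_cat opprD addrA mulrDl mulNr divfK// expf_neq0// gt_eqF//.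
Qed.

(** There are countably many words, and affine maps preserve null sets. *)
Lemma ae_remainder_well_approx : (0 < mu V)%E ->
  {ae mu, forall x, forall w, beta_interval b (remainder w x) -> V (remainder w x)}.
Proof.
move=> /(ae_well_approx b1 b2) aeV.
pose N := ~` [set x | beta_interval b x -> V x].
pose F k := if unpickle k is Some w then remainder w @^-1` N else set0.
have : mu.-negligible (\bigcup_k F k).
  apply: negligible_bigcup => k; rewrite /F; case: (unpickle k) => [w|].
    by apply: negligible_affine => //; rewrite exprn_gt0.
  exact: negligible_set0.
apply: negligibleS => x /= /existsNP[w Nw].
by exists (pickle w) => //; rewrite /F pickleK.
Qed.

Lemma beta_sumS eps n : beta_sum b eps n.+1 = beta_sum b eps n + (eps n.+1)%:R / b ^+ n.+1.
Proof. by rewrite /beta_sum big_nat_recr. Qed.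

Lemma beta_sum_le eps m n : (m <= n)%N -> beta_sum b eps m <= beta_sum b eps n.
Proof.
move=> /subnK <-; elim: (n - m)%N => [|k IH]; first by rewrite add0n.
by rewrite addSn beta_sumS (le_trans IH)// lerDl divr_ge0// exprn_ge0// ltW.
Qed.

Lemma beta_sum_wsum (eps : nat -> bool) w :
  (forall i, (i < size w)%N -> eps i.+1 = nth false w i) ->
  beta_sum b eps (size w) = wsum b w.
Proof.
elim/last_ind: w => [|w d IH] epsw; first by rewrite /beta_sum big_geq.
rewrite size_rcons beta_sumS -cats1 wsum_cat /= addr0 IH; last first.
  by move=> i iw; rewrite epsw ?size_rcons 1?ltnW// nth_rcons iw.
by rewrite epsw ?size_rcons// nth_rcons ltnn eqxx exprSr invfM mulrA mulrAC.
Qed.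

(** The new remainder falls in the interval again because the error, at most
[2 ^- size v], has been multiplied by [b ^+ size v] with [b < 2]. *)
Lemma well_approx_extend x w M : V (remainder w x) -> exists v : seq bool,
  [/\ (M <= size v)%N, beta_interval b (remainder (w ++ v) x) &
      0 <= x - wsum b (w ++ v) <= psi (size (w ++ v))].
Proof.
(* [8 ^ n] compensates for the loss in [radius_shift]; [M] forces the length. *)
set n := size w => /well_approxP/(_ (8 ^ n + M)%N)[v [jv /andP[yv0]]].
set j := (_ + _)%N in jv *; set m := size v; set y := remainder w x - wsum b v => yv.
have psi_ge0 k : 0 <= psi k by rewrite ltW// radius_gt0.
have bn1 : 1 <= b ^+ n by rewrite exprn_ege1// ltW.
exists v; split; first exact: leq_trans (leq_addl _ _) jv.
  rewrite remainder_cat -/y -/m /beta_interval /= in_itv /= mulr_ge0 ?exprn_ge0 ?(ltW b0)//=.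
  apply: (@le_trans _ _ 1); last first.
    by rewrite ler_pdivlMr ?subr_gt0// mul1r lerBlDl ltW.
  rewrite -ler_pdivlMr ?exprn_gt0//; apply: (le_trans yv).
  apply: (@le_trans _ _ (psi m)); first by rewrite ler_piMl// invf_le1// ler1n.
  apply: (le_trans (radius_le1 _ _)).
  by rewrite ler_pM2l// lef_pV2 ?posrE ?exprn_gt0// lerXn2r ?nnegrE// ltW.
have -> : x - wsum b (w ++ v) = y / b ^+ n.
  rewrite /y /remainder -/n wsum_cat opprD addrA mulrBl mulfK//.
  by rewrite expf_neq0// gt_eqF.
rewrite divr_ge0 ?exprn_ge0 ?(ltW b0)//= size_cat -/n -/m.
rewrite ler_pdivrMr; last exact: lt_le_trans bn1.
apply: (@le_trans _ _ (psi (n + m))); last by rewrite ler_peMr.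
apply: (le_trans yv); rewrite -ler_pdivlMl ?invr_gt0// invrK.
apply: (le_trans (radius_shift R m n)).
by rewrite ler_wpM2r// -natrX ler_nat -addSn leqW ?leq_addr.
Qed.

(** The words obtained by repeated extension are prefixes of one another, so they
define a sequence of digits. Its partial sums increase and, along the lengths of
these words, get arbitrarily close to [x] from below. *)
Lemma beta_expansion_glue x : beta_interval b x ->
  (forall w, beta_interval b (remainder w x) -> V (remainder w x)) ->
  exists2 eps : nat -> bool, beta_expansion b x eps &
    forall M, exists n, (M <= n)%N /\ 0 <= x - beta_sum b eps n <= psi n.
Proof.
move=> Ix remV.
pose good w := beta_interval b (remainder w x).
have ext w : exists v, good w -> [/\ (1 <= size v)%N, good (w ++ v) &
    0 <= x - wsum b (w ++ v) <= psi (size (w ++ v))].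
  have [gw|ngw] := pselect (good w); last by exists [::].
  by have [v vP] := well_approx_extend 1 (remV _ gw); exists v.
have [nxt nxtP] := choice ext.
pose f k := iter k (fun w => w ++ nxt w) [::].
have f_good k : good (f k).
  elim: k => [|k IH]; first by rewrite /good /remainder /= subr0 expr0 mulr1.
  by have [] := nxtP _ IH.
have f_approx k : 0 <= x - wsum b (f k.+1) <= psi (size (f k.+1)).
  by have [] := nxtP _ (f_good k).
have f_size k : (k <= size (f k))%N.
  elim: k => // k IH; rewrite /= size_cat -addn1 leq_add//.
  by have [] := nxtP _ (f_good k).
have f_nth k l i : (k <= l)%N -> (i < size (f k))%N -> nth false (f l) i = nth false (f k) i.
  move=> /subnK <- ik; elim: (l - k)%N => // d IH.
  have ikd : (i < size (f (d + k)))%N.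
    elim: d {IH} => // d IH; rewrite addSn /= size_cat; exact: ltn_addr.
  by rewrite addSn /= nth_cat ikd.
(* Digits are numbered from 1, and the word [f i] has at least [i] letters. *)
pose eps i := nth false (f i) i.-1.
have epsf k i : (i < size (f k))%N -> eps i.+1 = nth false (f k) i.
  move=> ik; rewrite -[eps _]/(nth false (f i.+1) i).
  case: (leqP k i.+1) => ki; first exact: f_nth.
  by rewrite (f_nth i.+1 k i (ltnW ki))//; exact: f_size.
have sumf k : beta_sum b eps (size (f k)) = wsum b (f k).
  by apply: beta_sum_wsum; exact: epsf.
have approx k : 0 <= x - beta_sum b eps (size (f k.+1)) <= psi (size (f k.+1)).
  by rewrite sumf.
exists eps; last by move=> M; exists (size (f M.+1)); split => //; rewrite ltnW.
apply/cvgrPdist_lt => e e0.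
have [M eM] : exists M : nat, M.+1%:R^-1 < e.
  exists (Num.truncn e^-1).
  by rewrite -[ltRHS]invrK ltf_pV2 ?posrE ?invr_gt0// truncnS_gt.
exists (size (f M.+1)) => // n /= Mn.
have /andP[_ upM] := approx M.
have xn : beta_sum b eps n <= x.
  have /andP[+ _] := approx n; rewrite subr_ge0; apply: le_trans.
  by apply: beta_sum_le; rewrite ltnW.
rewrite ger0_norm ?subr_ge0//; apply: le_lt_trans eM.
apply: (@le_trans _ _ (x - beta_sum b eps (size (f M.+1)))).
  by rewrite lerD2l lerN2 beta_sum_le.
apply: (le_trans upM); apply: (le_trans (radius_le1 _ _)).
rewrite div1r lef_pV2 ?posrE ?exprn_gt0// -natrX ler_nat.
by apply: leq_trans (f_size M.+1) _; rewrite ltnW// ltn_expl.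
Qed.
End expansion.

Theorem corollary1p5 (R : realType) (b : R) (hb1 : 1 < b) (hb2 : b < 2)
    (hb : garsia_number b) :
  {ae (@lebesgue_measure R), forall x : R, beta_interval b x ->
    exists2 eps : nat -> bool, beta_expansion b x eps &
      infinite_set [set n : nat | (2 <= n)%N /\
        0 <= x - beta_sum b eps n <= 1 / (n%:R * 2 ^+ n * ln n%:R)]}.
Proof.
have [C C0 sepC] := garsia_separation hb.
have V0 : (0 < lebesgue_measure (well_approx b))%E.
  by apply: lt_le_trans (mu_well_approx_ge hb1 C0 sepC); rewrite lte_fin divr_gt0.
have := ae_remainder_well_approx hb1 hb2 V0.
apply: (@filterS _ _ (ae_filter_ringOfSetsType _)) => x remV Ix.
have [eps expx approx] := beta_expansion_glue hb1 hb2 Ix remV.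
exists eps => // /finite_seqP[s sE].
(* The [+ 2] puts [n] above every element of [s] and makes it at least [2]. *)
have [n [n_large /andP[n0 nle]]] := approx (\max_(i <- s) i).+2%N.
have n2 : (2 <= n)%N by apply: leq_trans n_large.
have ns : n \in s.
  suff : [set` s] n by [].
  by rewrite -sE /=; split => //; rewrite n0 (le_trans nle)// radius_le_inv.
have := leq_bigmax_seq (F := fun i : nat => i) _ ns isT.
by rewrite leqNgt (ltn_trans _ n_large).
Qed.
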